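(* The sporadic simple Mathieu group $M_{22}$ (of order $443520$) has an Ordered Generating System.
   Context: Definition. A sequence of elements $a_1,\ldots,a_n$ of a group $G$ is an Ordered Generating System of $G$ if there exist non-negative integers $m_1,\ldots,m_n$ such that every element $g\in G$ has a unique representation of the form $g=a_1^{i_1}a_2^{i_2}\cdots a_n^{i_n}$ with integers $0\le i_k\le m_k$ for every $1\le k\le n$ (i.e. the exponent tuple $(i_1,\ldots,i_n)$ in this range exists and is unique). A group is said to have an Ordered Generating System if such a finite sequence exists. *)

(* Defs.v *)
From HB Require Import structures.
From mathcomp Require Import all_boot all_order all_algebra all_fingroup.

Set Implicit Arguments.
Unset Strict Implicit.
Unset Printing Implicit Defensive.

Import GRing.Theory.

Local Open Scope group_scope.

Definition is_OGS (gT : finGroupType) (G : {group gT}) (n : nat)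
    (a : 'I_n -> gT) : Prop :=
  (forall k, a k \in G) /\
  exists m : 'I_n -> nat,
    forall g, g \in G ->
      exists! i : {ffun 'I_n -> nat},
        (forall k, i k <= m k) /\ g = \prod_(k < n) a k ^+ i k.

Definition has_OGS (gT : finGroupType) (G : {group gT}) : Prop :=
  exists (n : nat) (a : 'I_n -> gT), is_OGS G a.

(* The projective line over the field of 23 elements; [None] is the point at  *)
(* infinity.                                                                  *)
Definition PL23 : finType := option 'F_23.

(* Conway's generators of the extended binary Golay code, as subsets of the   *)
(* projective line: the whole line, and the 23 translates of the set formed   *)
(* by infinity and the 11 non-squares.                                        *)
Definition golay_gen (i : PL23) : {set PL23} :=
  if i is Some a then
    None |: [set Some (a + b)%R | b : 'F_23 & ~~ [exists c, c ^+ 2 == b]%R]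
  else [set: PL23].

(* Binary words are identified with their supports, so the F_2-linear         *)
(* combinations of the generators are the symmetric differences of the        *)
(* subfamilies of [golay_gen].                                                *)
Definition golay_code : {set {set PL23}} :=
  [set [set x | odd #|[set i in I | x \in golay_gen i]|] | I : {set PL23}].

(* M24 is the automorphism group of the extended Golay code: the global       *)
(* stabiliser of the code in the symmetric group on the 24 coordinates.       *)
Definition M24 : {group {perm PL23}} := 'N(golay_code | 'P^*)%G.

(* M22 is the pointwise stabiliser of two points in M24; as M24 is 5-fold     *)
(* transitive, the choice of the two points does not matter up to conjugacy.  *)
Definition M22 : {group {perm PL23}} :=
  'C_M24([set None; Some 0%R] | 'P)%G.

(* Main.v *)
(* If the powers a^0, ..., a^m of finitely many elements multiply out to a      *)
(* transversal of the stabiliser of a point x in a permutation group G, they    *)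
(* can be appended to an ordered generating system of that stabiliser.          *)
(* Starting from M22, the points 1, 2, 3, 4, 5 are stabilised in turn; their    *)
(* orbits have sizes 22, 21, 20, 16 and 3 and the last stabiliser is trivial.   *)
(* Upper bounds on the orbits, and the triviality at the end, come from the     *)
(* minimum weight 8 of the Golay code: a codeword w with at most three points   *)
(* outside a set F is preserved by every g in M24 that fixes F pointwise, since *)
(* the codeword w + g w has weight at most 6.                                   *)

Require Import Defs.
From Stdlib Require Import NArith.
From mathcomp Require Import all_boot all_order all_algebra all_fingroup.

Set Implicit Arguments.
Unset Strict Implicit.
Unset Printing Implicit Defensive.

Import GRing.Theory.

Local Open Scope group_scope.

(** * Ordered generating systems along a stabiliser chain *)

(** Modulo the stabiliser of [x], a permutation is determined by the image of [x]. So if the bounded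
    power products of some elements send [x] once to each point of its orbit, they represent each
    coset once, and [ogs_stab] appends them to a system for the stabiliser. Five such steps lead
    from the trivial group up to M22; their exponent boxes hold 3, 16, 20, 21 and 22 tuples, with
    product 443520.

    Each step needs explicit automorphisms of the Golay code and a proof that the orbit is no larger
    than the points they reach. For the automorphisms, a systematic basis reduces membership in the
    code to the test [recode w == w] ([recode_codeword], [table_in_fixerP]). For the orbit bound,
    codewords nearly contained in the fixed set are invariant ([rigid_words_inv]), so no group
    element maps [x] to a point that such a word separates from it. *)

Fixpoint ogs_eval (gT : finGroupType) (a : seq gT) (e : seq nat) : gT :=
  match a, e with
  | x :: a', i :: e' => x ^+ i * ogs_eval a' e'
  | _, _ => 1
  end.

Definition in_box (m e : seq nat) : bool := all2 leq e m.

Definition ogs (gT : finGroupType) (G : {group gT}) (a : seq gT) (m : seq nat)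
    : Prop :=
  [/\ size a = size m, {subset a <= G},
      {in in_box m &, injective (ogs_eval a)}
    & forall g, g \in G -> exists2 e, in_box m e & ogs_eval a e = g].

Lemma in_box_size m e : in_box m e -> size e = size m.
Proof. by rewrite /in_box all2E => /andP[/eqP]. Qed.

Lemma in_box_cat m n e f : size e = size m ->
  in_box (m ++ n) (e ++ f) = in_box m e && in_box n f.
Proof.
elim: m e => [|i m IHm] [|j e] //= [] sz.
by move: (IHm e sz); rewrite /in_box /= => ->; rewrite andbA.
Qed.

Lemma ogs_eval_cat (gT : finGroupType) (a b : seq gT) e f : size e = size a ->
  ogs_eval (a ++ b) (e ++ f) = ogs_eval a e * ogs_eval b f.
Proof.
elim: a e => [|x a IHa] [|i e] //=; first by rewrite mul1g.
by move=> [] /IHa ->; rewrite mulgA.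
Qed.

Lemma ogs_eval_in (gT : finGroupType) (G : {group gT}) (a : seq gT) e :
  {subset a <= G} -> ogs_eval a e \in G.
Proof.
elim: a e => [|x a IHa] [|i e] //= sub.
apply: groupM; first by rewrite groupX ?sub ?mem_head.
by apply: IHa => y ya; apply: sub; apply: mem_behead.
Qed.

Lemma ogs_eval_prod (gT : finGroupType) (a : seq gT) e : size e = size a ->
  ogs_eval a e = \prod_(k < size a) nth 1 a k ^+ nth 0%N e k.
Proof.
elim: a e => [|x a IHa] [|i e] //=; first by rewrite big_ord0.
by move=> [] /IHa ->; rewrite big_ord_recl.
Qed.

Lemma ogs_has_OGS (gT : finGroupType) (G : {group gT}) a m :
  ogs G a m -> has_OGS G.
Proof.
case=> szm sub inj surj.
exists (size a), (fun k => nth 1 a k); split=> [k|].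
  by rewrite sub ?mem_nth.
exists (fun k => nth 0%N m k) => g /surj[e be eg].
have sze : size e = size a by rewrite szm (in_box_size be).
have leP (f : seq nat) : size f = size a ->
    (forall k : 'I_(size a), nth 0 f k <= nth 0 m k)%N <-> in_box m f.
  move=> szf; rewrite /in_box all2E szf -szm eqxx /=; split=> [le_fm|].
    apply/(all_nthP (0, 0)%N) => k; rewrite size_zip szf -szm minnn => lt_k.
    rewrite nth_zip ?szf //=.
    exact: (le_fm (Ordinal lt_k)).
  move/(all_nthP (0, 0)%N) => le_fm k; have := le_fm k.
  by rewrite size_zip szf -szm minnn ltn_ord nth_zip ?szf //=; apply.
exists [ffun k : 'I_(size a) => nth 0%N e k]; split.
  split=> [k|]; first by rewrite ffunE; apply: (iffRL (leP e sze)).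
  by rewrite -eg ogs_eval_prod //; apply: eq_bigr => k _; rewrite ffunE.
move=> i [le_i prod_i]; pose f := [seq i k | k <- enum 'I_(size a)].
have szf : size f = size a by rewrite size_map size_enum_ord.
have nth_f (k : 'I_(size a)) : nth 0%N f k = i k.
  by rewrite (nth_map k) ?size_enum_ord ?nth_ord_enum.
have bf : in_box m f by apply/(leP f szf) => k; rewrite nth_f.
have ef : e = f.
  apply: inj => //; rewrite eg prod_i (ogs_eval_prod szf).
  by apply: eq_bigr => k _; rewrite nth_f.
by apply/ffunP=> k; rewrite ffunE ef nth_f.
Qed.

(** Products act from left to right, so the stabiliser factor acts first and fixes [x]: the image of
    [x] depends only on the [b] part. That image recovers the [b] exponents, and cancellation leaves
    an equation inside the stabiliser. *)
Lemma ogs_stab (T : finType) (G : {group {perm T}}) (x : T) a m b n :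
    ogs 'C_G[x | 'P] a m -> size b = size n -> {subset b <= G} ->
    {in in_box n &, injective (fun e => ogs_eval b e x)} ->
    (forall g, g \in G -> exists2 e, in_box n e & ogs_eval b e x = g x) ->
  ogs G (a ++ b) (m ++ n).
Proof.
case=> szm suba inja surja szn subb injb surjb.
have stabP g : (g \in 'C_G[x | 'P]) = (g \in G) && (g x == x).
  rewrite inE; congr (_ && _); apply/astab1P/eqP; by rewrite /= /aperm.
have split_box e : in_box (m ++ n) e ->
    exists u v, [/\ e = u ++ v, in_box m u & in_box n v].
  move=> be; exists (take (size m) e), (drop (size m) e).
  have sze := in_box_size be.
  have sztake : size (take (size m) e) = size m.
    by rewrite size_takel // sze size_cat leq_addr.
  rewrite cat_take_drop; split=> //; move: be;
    by rewrite -{1}(cat_take_drop (size m) e) in_box_cat // => /andP[].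
split; first by rewrite !size_cat szm szn.
- move=> g; rewrite mem_cat => /orP[/suba|/subb //].
  by rewrite stabP => /andP[].
- move=> e f /split_box[u [v [-> bu bv]]] /split_box[u' [v' [-> bu' bv']]].
  rewrite !ogs_eval_cat ?szm ?(in_box_size bu) ?(in_box_size bu') // => eq_uv.
  have fix_x w : ogs_eval a w x = x.
    by have := ogs_eval_in w suba; rewrite stabP => /andP[_ /eqP].
  have eq_v : v = v'.
    by apply: injb => //; have := congr1 (fun g : {perm T} => g x) eq_uv;
       rewrite !permM !fix_x.
  by rewrite eq_v in eq_uv *; rewrite (inja _ _ bu bu' (mulIg _ _ _ eq_uv)).
(* Existence: divide [g] on the right by the [b] product that moves [x] to the same point; the
   quotient fixes [x]. *)
- move=> g Gg; have [v bv vx] := surjb g Gg.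
  have [|u bu uE] := surja (g * (ogs_eval b v)^-1).
    rewrite stabP groupM ?groupV ?ogs_eval_in //=.
    by rewrite permM -vx permK.
  exists (u ++ v); first by rewrite in_box_cat ?bu ?bv ?(in_box_size bu).
  by rewrite ogs_eval_cat ?uE ?mulgKV ?szm ?(in_box_size bu).
Qed.

Definition box (m : seq nat) : seq (seq nat) :=
  foldr (fun k l => [seq i :: e | i <- iota 0 k.+1, e <- l]) [:: [::]] m.

Lemma mem_box m e : (e \in box m) = in_box m e.
Proof.
elim: m e => [|k m IHm] e; first by rewrite inE; case: e.
rewrite -[box _]/[seq i :: f | i <- iota 0 k.+1, f <- box m].
apply/allpairsPdep/idP => [[i [f []]]|].
  by rewrite mem_iota add0n ltnS IHm => /= le_i bf ->; rewrite /in_box /= le_i.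
case: e => [|i e] //; rewrite /in_box /= => /andP[le_i be]; exists i, e.
by rewrite -[0%N :: _]/(iota 0 k.+1) mem_iota IHm; split.
Qed.

Lemma uniq_map_inj (T1 T2 : eqType) (f : T1 -> T2) (s : seq T1) :
  uniq (map f s) -> {in s &, injective f}.
Proof.
elim: s => [|z s IHs] //= /andP[zs /IHs inj] x y.
rewrite !inE => /predU1P[->|xs] /predU1P[->|ys] eq_f //.
- by rewrite eq_f map_f in zs.
- by rewrite -eq_f map_f in zs.
- exact: inj.
Qed.

(** * Binary words on the projective line *)

(* The point [a] of F_23 is numbered by its residue and infinity by 23. *)
Definition idx (x : PL23) : nat := if x is Some a then val a else 23.
Definition pt (k : nat) : PL23 := if (k < 23)%N then Some (inZp k) else None.

Lemma idx_lt x : (idx x < 24)%N.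
Proof. by case: x => [a|] //=; apply: ltnW; apply: (ltn_ord a). Qed.

Lemma idxK : cancel idx pt.
Proof.
case=> [a|] //; rewrite /pt /= (ltn_ord a : (a < 23)%N).
by congr Some; apply: valZpK.
Qed.

Lemma ptK k : (k < 24)%N -> idx (pt k) = k.
Proof.
rewrite /pt; case: (ltnP k 23) => [lt_k _|le_k lt_k] /=; first exact: (modn_small lt_k).
by apply/eqP; rewrite eqn_leq le_k -ltnS lt_k.
Qed.

Definition bit (w : N) (k : nat) : bool := N.testbit w (N.of_nat k).
Definition word (f : nat -> bool) : N :=
  foldr (fun k w => if f k then N.setbit w (N.of_nat k) else w) 0%num (iota 0 24).
Definition pts (w : N) : {set PL23} := [set x | bit w (idx x)].

Lemma bit_xor u v k : bit (N.lxor u v) k = bit u k (+) bit v k.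
Proof. by rewrite /bit N.lxor_spec; do 2!case: N.testbit. Qed.

Lemma bit_word f k : (k < 24)%N -> bit (word f) k = f k.
Proof.
move=> lt_k; have : k \in iota 0 24 by rewrite mem_iota.
have bitE s : bit (foldr (fun k w => if f k then N.setbit w (N.of_nat k) else w)
    0%num s) k = (k \in s) && f k.
  elim: s => [|j s IHs] //=; rewrite inE.
  have [<-|ne_kj] := eqVneq k j.
    by case: ifP => fk; [rewrite /bit N.setbit_eq | rewrite IHs fk andbF].
  case: ifP => // _; rewrite /bit N.setbit_neq // => /Nnat.Nat2N.inj eq_jk.
  by rewrite eq_jk eqxx in ne_kj.
by rewrite /word bitE => ->.
Qed.

Lemma card_pts w : #|pts w| = count (bit w) (iota 0 24).
Proof.
have uniq_pt : uniq (map pt (iota 0 24)).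
  rewrite map_inj_in_uniq ?iota_uniq // => j k.
  by rewrite !mem_iota => /ptK {2}<- /ptK {2}<- ->.
have enumE : perm_eq (map pt (iota 0 24)) (enum PL23).
  apply: uniq_perm => // [|x]; first exact: enum_uniq.
  rewrite mem_enum; apply/mapP; exists (idx x); last by rewrite idxK.
  by rewrite mem_iota idx_lt.
rewrite cardE {1}/enum_mem -enumT size_filter -(seq.permP enumE) count_map.
apply: eq_in_count => k.
by rewrite mem_iota /= inE => /ptK ->.
Qed.

(** * The Golay code *)

Definition nonsquares : seq nat := [:: 5; 7; 10; 11; 14; 15; 17; 19; 20; 21; 22].

(** The sum [k + (23 - i)] is the difference [k - i] modulo 23, written without truncated
    subtraction. *)
Definition gen (i : nat) : N :=
  word (fun k => if (i < 23)%N then (k == 23) || ((k + (23 - i)) %% 23 \in nonsquares)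
                 else true).

Lemma nonsquaresP (b : 'F_23) :
  (~~ [exists c : 'F_23, c ^+ 2 == b]%R) = (val b \in nonsquares).
Proof.
apply/existsPn/idP => [nsq|].
  (* Square roots modulo 23; the entry 0 at a nonsquare is only a filler. *)
  pose root : seq nat := [:: 0; 1; 5; 7; 2; 0; 11; 0; 10; 3; 0; 0; 9; 6; 0; 0; 4; 0; 8; 0; 0; 0; 0]%N.
  apply: contraT; have := nsq (inZp (nth 0%N root b)).
  case: b {nsq} => b lt_b.
  do 23?[case: b lt_b => [|b] lt_b; first by vm_compute].
  by [].
move=> + c; apply: contraTneq => <-.
case: c => c lt_c.
do 23?[case: c lt_c => [|c] lt_c; first by vm_compute].
by [].
Qed.

Lemma golay_genE i : golay_gen i = pts (gen (idx i)).
Proof.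
apply/setP=> x; rewrite inE bit_word ?idx_lt //.
case: i => [a|] /=; last by rewrite inE.
rewrite (ltn_ord a : (a < 23)%N); case: x => [c|]; last by rewrite !inE.
rewrite in_setU1 /= (ltn_eqF (ltn_ord c : (c < 23)%N)) /=.
have valB : ((c + (23 - a)) %% 23)%N = val (c - a)%R by rewrite /= modnDmr.
rewrite valB -nonsquaresP; apply/imsetP/idP => [[b]|nsq].
  by rewrite inE => nsq [->]; rewrite addrC addKr.
by exists (c - a)%R; rewrite ?inE // addrC subrK.
Qed.

Definition codeword (s : seq nat) : N :=
  foldr (fun i w => N.lxor (gen i) w) 0%num s.

Lemma codeword_cat s t : codeword (s ++ t) = N.lxor (codeword s) (codeword t).
Proof. by elim: s => [|i s IHs] //=; rewrite IHs N.lxor_assoc. Qed.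

(** Adding generator [j] to a sum toggles [j] in its index set. With [C] the indices of the
    generators through a point, this tracks the coefficient at that point, so lists with repetitions
    give the same sums as index sets. *)
Lemma odd_card_toggle (T : finType) (I C : {set T}) j :
  odd #|(if j \in I then I :\ j else j |: I) :&: C|
    = (j \in C) (+) odd #|I :&: C|.
Proof.
set J := if _ then _ else _.
have jJ : (j \in J) = (j \notin I) by rewrite /J; case: ifP; rewrite !inE eqxx.
have JD : (J :&: C) :\ j = (I :&: C) :\ j.
  apply/setP=> i; rewrite /J; case: ifP => _; rewrite !inE;
  by case: (i == j).
rewrite (cardsD1 j (J :&: C)) (cardsD1 j (I :&: C)) JD !oddD !inE jJ.
by case: (j \in I); case: (j \in C); case: (odd #|_|).
Qed.

Lemma golay_codeP A :
  reflect (exists2 s, all (gtn 24) s & A = pts (codeword s)) (A \in golay_code).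
Proof.
apply: (iffP imsetP) => [[I _ ->]|[s s24 ->]].
  exists (map idx (enum I)).
    by rewrite all_map; apply/allP=> i _; apply: idx_lt.
  apply/setP=> x; rewrite !inE.
  transitivity (odd (count (fun i => x \in golay_gen i) (enum I))).
    congr (odd _); rewrite cardE /enum_mem size_filter count_filter.
    by apply: eq_count => i; rewrite !inE andbC.
  elim: (enum I) => [|i s IHs]; first by rewrite /bit N.bits_0.
  by rewrite /= bit_xor oddD -IHs golay_genE inE oddb.
elim: s s24 => [_|i s IHs /= /andP[i24 /IHs[I _ sE]]].
  exists set0 => //; apply/setP=> x; rewrite !inE /bit N.bits_0.
  by rewrite (_ : [set i in set0 | _] = set0) ?cards0 //; apply/setP=> i; rewrite !inE.
exists (if pt i \in I then I :\ pt i else pt i |: I) => //.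
apply/setP=> x; have := congr1 (fun A : {set PL23} => x \in A) sE.
rewrite !inE bit_xor => ->.
pose C := [set j | x \in golay_gen j].
have -> (J : {set PL23}) : [set j in J | x \in golay_gen j] = J :&: C.
  by apply/setP=> j; rewrite !inE.
have -> (J : {set PL23}) : [set j in J | x \in golay_gen j] = J :&: C.
  by apply/setP=> j; rewrite !inE.
by rewrite odd_card_toggle inE golay_genE inE ptK.
Qed.

Definition gens : seq N := Eval vm_compute in map gen (iota 0 24).

Lemma gensE : gens = map gen (iota 0 24).
Proof. by vm_compute. Qed.

(* The [k]-th of these sums of generators meets {0, ..., 11} in [k] only. *)
Definition basis_sums : seq (seq nat) :=
  [:: [:: 1; 3; 6; 10; 11];
      [:: 0; 1; 3; 4; 5; 6; 7; 8; 9; 11];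
      [:: 0; 3; 4; 7; 10];
      [:: 3; 4; 5; 6; 8; 10];
      [:: 1; 3; 4; 5; 7; 9; 10];
      [:: 2; 4; 5; 6; 8; 10; 11];
      [:: 0; 2; 3; 6; 7; 8; 10];
      [:: 4; 6; 7; 8; 9; 10];
      [:: 5; 7; 8; 9; 10; 11];
      [:: 0; 2; 5; 6];
      [:: 7; 10; 11];
      [:: 0; 2; 5; 9; 10]]%N.

Definition basis : seq N := Eval vm_compute in map codeword basis_sums.

Lemma basisE : basis = map codeword basis_sums.
Proof. by vm_compute. Qed.

(* The unique codeword that agrees with [w] on {0, ..., 11}. *)
Definition recode (w : N) : N :=
  foldr (fun k v => if bit w k then N.lxor (nth 0%num basis k) v else v) 0%num
    (iota 0 12).

Definition span (B : seq N) : seq N :=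
  foldr (fun b l => l ++ map (N.lxor b) l) [:: 0%num] B.

Definition code_words : seq N := span basis.

(** [recode] is linear over F_2 and fixes the 24 generators, hence fixes all their sums. *)
Lemma recode_codeword s : all (gtn 24) s -> recode (codeword s) = codeword s.
Proof.
have recode_xor u v : recode (N.lxor u v) = N.lxor (recode u) (recode v).
  rewrite /recode; elim: (iota 0 12) => [|k l] //=; rewrite bit_xor => ->.
  move: (nth _ _ _) (foldr _ _ _) (foldr _ _ _) => b ru rv.
  by case: (bit u k); case: (bit v k) => //=; apply: N.bits_inj => n;
    rewrite !N.lxor_spec; do 3!case: N.testbit.
have recode_gen i : (i < 24)%N -> recode (gen i) = gen i.
  move=> i24; have /allP/(_ (gen i)) : all (fun w => recode w == w) gens.
    by vm_compute.
  by rewrite gensE map_f ?mem_iota // => /(_ isT)/eqP.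
elim: s => [|i s IHs] //= /andP[i24 /IHs IH].
by rewrite recode_xor recode_gen ?IH.
Qed.

Lemma basis_codeword w : w \in basis ->
  exists2 s, all (gtn 24) s & w = codeword s.
Proof.
rewrite basisE => /mapP[s sB ->]; exists s => //.
by have /allP/(_ s sB) : all (all (gtn 24)) basis_sums by vm_compute.
Qed.

Lemma mem_recode w : recode w \in code_words.
Proof.
have mem_span (b : nat -> N) l :
    foldr (fun k v => if bit w k then N.lxor (b k) v else v) 0%num l
      \in span (map b l).
  elim: l => [|k l IHl] /=; first exact: mem_head.
  by rewrite mem_cat; case: ifP => _; rewrite ?map_f ?IHl ?orbT.
have basisI : basis = map (nth 0%num basis) (iota 0 12) by vm_compute.
by have := mem_span (nth 0%num basis) (iota 0 12); rewrite -basisI.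
Qed.

Lemma span_codeword (B : seq N) w : {subset B <= basis} -> w \in span B ->
  exists2 s, all (gtn 24) s & w = codeword s.
Proof.
elim: B w => [|b B IHB] w sub; first by rewrite inE => /eqP ->; exists [::].
have subB : {subset B <= basis} by move=> c cB; rewrite sub // inE cB orbT.
rewrite mem_cat => /orP[|/mapP[v]] /(IHB _ subB) [s s24 ->]; first by exists s.
move=> ->; have [|t t24 ->] := @basis_codeword b; first by rewrite sub ?mem_head.
by exists (t ++ s); rewrite ?all_cat ?t24 // codeword_cat.
Qed.

Lemma code_words_golay w : w \in code_words -> pts w \in golay_code.
Proof.
move=> wC; apply/golay_codeP.
by have [|s s24 ->] := span_codeword _ wC; [|exists s].
Qed.

Lemma golay_code_word A : A \in golay_code -> exists2 w, w \in code_words & A = pts w.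
Proof.
case/golay_codeP=> s /recode_codeword <- ->.
by exists (recode (codeword s)); first exact: mem_recode.
Qed.

Lemma golay_code_xor u v : pts u \in golay_code -> pts v \in golay_code ->
  pts (N.lxor u v) \in golay_code.
Proof.
case/golay_codeP=> s s24 uE /golay_codeP[t t24 vE]; apply/golay_codeP.
exists (s ++ t); first by rewrite all_cat s24.
apply/setP=> x; rewrite codeword_cat !inE !bit_xor.
by have /setP/(_ x) := uE; have /setP/(_ x) := vE; rewrite !inE => -> ->.
Qed.

(** By exhaustion over the 4096 sums of the twelve basis words. *)
Lemma golay_min_weight A : A \in golay_code -> (#|A| < 8)%N -> A = set0.
Proof.
case/golay_code_word=> w wC ->; rewrite card_pts.
have /allP/(_ w wC) : all (fun w => (w == 0%num) ||
    (7 < count (bit w) (iota 0 24))%N) code_words by vm_compute.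
case/orP=> [/eqP-> _|]; last by rewrite ltnS ltnNge => /negbTE ->.
by apply/setP=> x; rewrite !inE /bit N.bits_0.
Qed.

(** * Permutations given by tables *)

Definition table_fun (t : seq nat) (x : PL23) : PL23 := pt (nth 0%N t (idx x)).
Definition table_perm (t : seq nat) : {perm PL23} :=
  if insub (finfun (table_fun t)) is Some g then g else 1.

Lemma table_permE t x : perm_eq t (iota 0 24) ->
  idx (table_perm t x) = nth 0%N t (idx x).
Proof.
move=> tP; have szt : size t = 24 by rewrite (perm_size tP) size_iota.
have t_lt k : (k < 24)%N -> (nth 0%N t k < 24)%N.
  move=> k24; have := mem_nth 0%N (_ : k < size t)%N.
  by rewrite (perm_mem tP) mem_iota szt; apply.
have injt : injectiveb (finfun (table_fun t)).
  apply/injectiveP=> y z; rewrite !ffunE => /(congr1 idx).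
  rewrite !ptK ?t_lt ?idx_lt // => /eqP.
  rewrite nth_uniq ?szt ?idx_lt ?(perm_uniq tP) ?iota_uniq // => /eqP.
  exact: (can_inj idxK).
by rewrite /table_perm insubT /= -pvalE ffunE ptK ?t_lt ?idx_lt.
Qed.

Definition preserves_code (t : seq nat) : bool :=
  all (fun g => let w := word (fun k => bit g (nth 0%N t k)) in recode w == w) gens.

Definition table_in_fixer (F : seq nat) (t : seq nat) : bool :=
  [&& perm_eq t (iota 0 24), preserves_code t & all (fun k => nth 0%N t k == k) F].

Definition fixer (F : seq nat) : {group {perm PL23}} :=
  'C_M24([set x | idx x \in F] | 'P)%G.

(** The preimage under [g] is the image under its inverse, and M24 is closed under inversion. *)
Lemma M24P (g : {perm PL23}) :
  (forall A, A \in golay_code -> g @^-1: A \in golay_code) -> g \in M24.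
Proof.
move=> gC; rewrite -groupV !inE; apply/subsetP=> A /gC.
by rewrite inE /= /setact -(preim_permV g^-1 A) invgK.
Qed.

Lemma M24_imset (g : {perm PL23}) A : g \in M24 -> A \in golay_code ->
  g @: A \in golay_code.
Proof. by move=> gM; rewrite -(astabs_act A gM). Qed.

Lemma fixerP (F : seq nat) (g : {perm PL23}) :
  reflect (g \in M24 /\ forall x, idx x \in F -> g x = x) (g \in fixer F).
Proof.
have -> : (g \in fixer F) = (g \in M24) && (g \in 'C([set x | idx x \in F] | 'P)).
  exact: in_setI.
apply: (iffP andP) => [] [gM gF]; split=> //.
  by move=> x xF; move/astabP: gF; apply; rewrite inE.
by apply/astabP=> x; rewrite inE => /gF.
Qed.

Lemma fixer_cons F k : (k < 24)%N -> fixer (k :: F) = 'C_(fixer F)[pt k | 'P]%G.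
Proof.
move=> k24; apply: val_inj; rewrite /= -setIA -astabU; congr (_ :&: 'C(_ | _)).
apply/setP=> x; rewrite !inE orbC; congr (_ || _).
by rewrite -(inj_eq (can_inj idxK)) ptK.
Qed.

(** Preimages commute with symmetric differences, so it suffices that the preimages of the
    generators are codewords. *)
Lemma table_in_fixerP F t : table_in_fixer F t -> table_perm t \in fixer F.
Proof.
case/and3P=> tP /allP tC /allP tF; apply/fixerP; split=> [|x /tF/eqP xF]; last first.
  by apply: (can_inj idxK); rewrite table_permE.
apply: M24P => A /golay_codeP[s s24 ->].
have -> : table_perm t @^-1: pts (codeword s)
    = pts (word (fun k => bit (codeword s) (nth 0%N t k))).
  by apply/setP=> x; rewrite !inE bit_word ?idx_lt // table_permE.
elim: s s24 => [_|i s IHs /= /andP[i24 /IHs IH]].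
  suff -> : pts (word (fun k => bit 0 (nth 0%N t k))) = pts 0.
    by apply: code_words_golay.
  by apply/setP=> x; rewrite !inE bit_word ?idx_lt // /bit !N.bits_0.
have -> : pts (word (fun k => bit (N.lxor (gen i) (codeword s)) (nth 0%N t k))) =
    pts (N.lxor (word (fun k => bit (gen i) (nth 0%N t k)))
                (word (fun k => bit (codeword s) (nth 0%N t k)))).
  by apply/setP=> x; rewrite !inE [in RHS]bit_xor [LHS]bit_word ?idx_lt // bit_xor; congr (_ (+) _); rewrite bit_word ?idx_lt.
apply: golay_code_xor => //.
have /tC/eqP <- : gen i \in gens by rewrite gensE map_f ?mem_iota.
exact/code_words_golay/mem_recode.
Qed.

(** * Invariant codewords from the minimum weight *)

Definition rigid_words (F : seq nat) : seq N :=
  [seq w <- code_words | (count (fun k => bit w k && (k \notin F)) (iota 0 24) <= 3)%N].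

Lemma rigid_words_inv F g w x : g \in fixer F -> w \in rigid_words F ->
  bit w (idx (g x)) = bit w (idx x).
Proof.
case/fixerP=> gM gF; rewrite mem_filter => /andP[le3 /code_words_golay wC].
pose A := pts w; pose D := A :\: [set x | idx x \in F].
have [v _ vE] := golay_code_word (M24_imset gM wC).
have vP y : bit v (idx y) = (y \in g @: A) by rewrite -/A in vE; rewrite vE inE.
(* Since [g] fixes [F] pointwise, [w] and its image [v] agree on [F]; their sum therefore lives on
   [D] and its image, at most six points. *)
have subD : pts (N.lxor w v) \subset D :|: g @: D.
  apply/subsetP=> y; rewrite !inE bit_xor vP.
  have [yF|yF] /= := boolP (idx y \in F).
    by rewrite -[y in y \in g @: A](gF y yF) (mem_imset _ _ perm_inj) inE addbb.
  case: (bit w (idx y)) => //= /imsetP[z zA yE].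
  rewrite {1}yE (mem_imset _ _ perm_inj) in_setD zA andbT inE.
  by apply: contra yF => zF; rewrite yE gF.
have D3 : (#|D| <= 3)%N.
  have -> : D = pts (word (fun k => bit w k && (k \notin F))).
    by apply/setP=> y; rewrite !inE bit_word ?idx_lt // andbC.
  rewrite card_pts; apply: leq_trans le3; rewrite leq_eqVlt; apply/orP; left.
  by apply/eqP/eq_in_count => k; rewrite mem_iota => k24; rewrite bit_word.
have : pts (N.lxor w v) = set0.
  apply: golay_min_weight.
    by apply: golay_code_xor; rewrite // -vE M24_imset.
  apply: leq_ltn_trans (subset_leq_card subD) _.
  rewrite cardsU ltnS (leq_trans (leq_subr _ _)) // card_imset; last exact: perm_inj.
  exact: (leq_trans (leq_add D3 D3)).
move/setP/(_ (g x)); rewrite !inE bit_xor vP (mem_imset _ _ perm_inj) inE.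
by case: bit; case: bit.
Qed.

(** * Checking one level of the chain by computation *)

Fixpoint table_act (ts : seq (seq nat)) (e : seq nat) (k : nat) : nat :=
  match ts, e with
  | t :: ts', i :: e' => table_act ts' e' (iter i (nth 0%N t) k)
  | _, _ => k
  end.

Lemma table_actE ts e x : all (fun t => perm_eq t (iota 0 24)) ts ->
  idx (ogs_eval (map table_perm ts) e x) = table_act ts e (idx x).
Proof.
elim: ts e x => [|t ts IHts] [|i e] x //=; rewrite ?perm1 // => /andP[tP tsP].
rewrite permM IHts // permX; congr table_act.
by elim: i => //= i <-; rewrite table_permE.
Qed.

Definition separates (ws : seq N) (j k : nat) : bool :=
  has (fun w => bit w j != bit w k) ws.

(** [uniq im] gives uniqueness of the exponents. The last conjunct confines the orbit of [x] to
    [im]: a point of [F] is fixed, so it is not an image of [x], and a separated point differs from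
    [x] on an invariant word. *)
Definition level_ok (F : seq nat) (x : nat) (ts : seq (seq nat)) (n : seq nat) :=
  let ws := rigid_words F in
  let im := [seq table_act ts e x | e <- box n] in
  [&& (x < 24)%N, x \notin F, size ts == size n, all (table_in_fixer F) ts, uniq im
    & all (fun k => [|| k \in F, k \in im | separates ws k x]) (iota 0 24)].

Lemma separatesP F g j x : g \in fixer F -> idx (g x) = j ->
  ~~ separates (rigid_words F) j (idx x).
Proof.
by move=> gF <-; apply/hasPn=> w wF; rewrite negbK (rigid_words_inv x gF wF).
Qed.

Lemma ogs_level F x ts n a m : level_ok F x ts n -> ogs (fixer (x :: F)) a m ->
  ogs (fixer F) (a ++ map table_perm ts) (m ++ n).
Proof.
case/and5P=> x24 xF /eqP sz tsF /andP[uniq_im /allP cover] ogs_x.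
have tsP : all (fun t => perm_eq t (iota 0 24)) ts.
  by apply: sub_all tsF => t /and3P[].
have actE e : idx (ogs_eval (map table_perm ts) e (pt x)) = table_act ts e x.
  by rewrite table_actE // ptK.
rewrite fixer_cons // in ogs_x; apply: ogs_stab ogs_x _ _ _ _.
- by rewrite size_map.
- by move=> _ /mapP[t /(allP tsF) tF ->]; apply: table_in_fixerP.
- move=> e f be bf /(congr1 idx); rewrite !actE.
  by apply: (uniq_map_inj uniq_im); rewrite mem_box.
- move=> g gF; have [_ gfix] := fixerP _ _ gF.
  have /cover : idx (g (pt x)) \in iota 0 24 by rewrite mem_iota idx_lt.
  case/or3P=> [kF|/mapP[e be kE]|].
  + by have := kF; rewrite (perm_inj (gfix _ kF)) ptK // (negPf xF).
  + by exists e; [rewrite -mem_box | apply: (can_inj idxK); rewrite actE].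
  + by rewrite -{2}(ptK x24) (negPf (separatesP gF (erefl _))).
Qed.

(** These points cannot move: a point separated from all others outside [F] could only go into [F],
    whose points are already their own images. *)
Definition rigid_closure (F : seq nat) : seq nat :=
  let ws := rigid_words F in
  [seq k <- iota 0 24 | (k \in F) ||
    all (fun j => [|| j == k, j \in F | separates ws j k]) (iota 0 24)].

Lemma rigid_closure_fixer F g : g \in fixer F -> g \in fixer (rigid_closure F).
Proof.
move=> gF; have [gM gfix] := fixerP _ _ gF; apply/fixerP; split=> // x.
rewrite mem_filter => /andP[/orP[/gfix //|/allP sep] _].
have /sep : idx (g x) \in iota 0 24 by rewrite mem_iota idx_lt.
case/or3P=> [/eqP/(can_inj idxK) //|/gfix/perm_inj //|].
by rewrite (negPf (separatesP gF (erefl _))).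
Qed.

(** * The stabiliser chain of M22 *)

Lemma M22_fixer : M22 = fixer [:: 23; 0]%N.
Proof.
apply: val_inj; congr (_ :&: 'C(_ | _)); apply/setP=> x.
rewrite !inE; case: x => [a|] //=.
by rewrite (ltn_eqF (ltn_ord a : (a < 23)%N)).
Qed.

Lemma fixer_trivial : fixer [:: 5; 4; 3; 2; 1; 23; 0]%N = 1%G.
Proof.
apply/eqP; rewrite -val_eqE eqEsubset sub1G andbT; apply/subsetP=> g.
move/rigid_closure_fixer/rigid_closure_fixer.
(* A larger fixed set has more rigid words, so the closure is iterated; two rounds reach all 24
   points. *)
have -> : rigid_closure (rigid_closure [:: 5; 4; 3; 2; 1; 23; 0]%N) = iota 0 24.
  by vm_compute.
case/fixerP=> _ gfix; rewrite inE; apply/eqP/permP=> x.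
by rewrite perm1 gfix // mem_iota idx_lt.
Qed.

(* Found by a random search in the stabiliser chain; [level4] generates the   *)
(* group 2^4 acting regularly on the complement of the octad                  *)
(* {infinity, 0, 1, 2, 3, 5, 14, 17}.                                         *)
Definition level1 : seq (seq nat) :=
  [:: [:: 0; 17; 2; 5; 12; 3; 6; 8; 7; 9; 16; 20; 4; 13; 14; 19; 10; 1; 18; 15; 11; 22; 21; 23];
      [:: 0; 10; 5; 21; 14; 20; 9; 17; 6; 12; 16; 4; 11; 22; 7; 19; 13; 3; 2; 18; 1; 8; 15; 23]]%N.
Definition level2 : seq (seq nat) :=
  [:: [:: 0; 1; 9; 21; 3; 5; 6; 17; 2; 8; 19; 15; 10; 7; 11; 14; 16; 13; 20; 12; 22; 4; 18; 23];
      [:: 0; 1; 21; 5; 10; 11; 15; 22; 7; 20; 8; 19; 2; 4; 13; 17; 18; 9; 6; 12; 16; 3; 14; 23]]%N.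
Definition level3 : seq (seq nat) :=
  [:: [:: 0; 1; 2; 18; 9; 8; 21; 19; 14; 13; 4; 3; 5; 10; 12; 22; 15; 11; 17; 7; 16; 6; 20; 23];
      [:: 0; 1; 2; 6; 9; 21; 8; 11; 13; 14; 3; 4; 22; 10; 7; 5; 15; 19; 16; 12; 17; 18; 20; 23]]%N.
Definition level4 : seq (seq nat) :=
  [:: [:: 0; 1; 2; 3; 18; 5; 15; 20; 22; 19; 21; 16; 13; 12; 14; 6; 11; 17; 4; 9; 7; 10; 8; 23];
      [:: 0; 1; 2; 3; 13; 5; 19; 21; 11; 15; 20; 8; 18; 4; 14; 9; 22; 17; 12; 6; 10; 7; 16; 23];
      [:: 0; 1; 2; 3; 6; 5; 4; 22; 20; 12; 11; 10; 9; 19; 14; 18; 21; 17; 15; 13; 8; 16; 7; 23];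
      [:: 0; 1; 2; 3; 11; 5; 10; 9; 13; 7; 6; 4; 22; 8; 14; 21; 18; 17; 16; 20; 19; 15; 12; 23]]%N.
Definition level5 : seq (seq nat) :=
  [:: [:: 0; 1; 2; 3; 4; 14; 15; 10; 21; 8; 12; 19; 7; 22; 17; 18; 13; 5; 6; 20; 11; 9; 16; 23]]%N.

Theorem theorem5 : has_OGS M22.
Proof.
have ogs_fixer5 : ogs (fixer [:: 5; 4; 3; 2; 1; 23; 0]%N) [::] [::].
  rewrite fixer_trivial; split=> // [[|i e] [|j f] //|g /set1P ->].
  by exists [::].
(* The lists are maximal exponents, so [[:: 1; 10]] stands for 2 * 11 tuples. With at most four
   fixed points a rigid word has weight at most 7, hence is empty: in the first three levels the
   products must reach every point outside [F]. *)
have ok1 : level_ok [:: 23; 0]%N 1%N level1 [:: 1; 10]%N by vm_compute.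
have ok2 : level_ok [:: 1; 23; 0]%N 2%N level2 [:: 2; 6]%N by vm_compute.
have ok3 : level_ok [:: 2; 1; 23; 0]%N 3%N level3 [:: 3; 4]%N by vm_compute.
(* From five fixed points on, the octad through them is rigid. It separates the 16 points outside
   it, the orbit of 4, from its remaining points 5, 14 and 17, which form the orbit of 5 at the next
   level. *)
have ok4 : level_ok [:: 3; 2; 1; 23; 0]%N 4%N level4 [:: 1; 1; 1; 1]%N by vm_compute.
have ok5 : level_ok [:: 4; 3; 2; 1; 23; 0]%N 5%N level5 [:: 2]%N by vm_compute.
rewrite M22_fixer; apply: ogs_has_OGS.
exact: (ogs_level ok1 (ogs_level ok2 (ogs_level ok3 (ogs_level ok4
  (ogs_level ok5 ogs_fixer5))))).
Qed.
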